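(* Let $X$ be a finite simple quandle. Then $\operatorname{Inn}(X)$, acting naturally on $X$, is a quasiprimitive group; that is, its action on $X$ is a quasiprimitive group action.
   Context: A quandle is a set $X$ with a binary operation $\triangleright$ such that (1) $x\triangleright x=x$ for all $x$; (2) for every $x\in X$ the right translation $R_x:X\to X$, $R_x(y)=y\triangleright x$, is a bijection; (3) $(x\triangleright y)\triangleright z=(x\triangleright z)\triangleright(y\triangleright z)$ for all $x,y,z$. The operation $\triangleright^{-1}$ is defined by $x\triangleright^{-1}y=z$ if and only if $x=z\triangleright y$. A quandle homomorphism is a map $f$ between quandles with $f(x\triangleright y)=f(x)\triangleright f(y)$ and $f(x\triangleright^{-1}y)=f(x)\triangleright^{-1}f(y)$. The inner automorphism group is $\operatorname{Inn}(X)=\langle R_x : x\in X\rangle\le \operatorname{Sym}(X)$. A quandle $X$ is simple if $|X|>1$ and every quandle homomorphism from $X$ to a quandle is either injective or constant. An action of a group $G$ on a set $X$ is quasiprimitive if it is faithful and the restriction of the action to every nontrivial normal subgroup of $G$ is transitive on $X$. *)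

(* Defs.v *)
From HB Require Import structures.
From mathcomp Require Import all_boot all_fingroup.

Set Implicit Arguments.
Unset Strict Implicit.
Unset Printing Implicit Defensive.

Declare Scope quandle_scope.
Delimit Scope quandle_scope with Q.

(* The field [qdivP] determines [qdiv] from [qop]; since [qop] is right        *)
(* invertible, carrying [qdiv] adds no data, and it makes x |>^-1 y an honest  *)
(* operation on arbitrary, possibly infinite, carriers without using choice.   *)
HB.mixin Record isQuandle (X : Type) := {
  qop : X -> X -> X;
  qdiv : X -> X -> X;
  qopxx : forall x, qop x x = x;
  qop_bij : forall x, bijective (fun y => qop y x);
  qopDr : forall x y z, qop (qop x y) z = qop (qop x z) (qop y z);
  qdivP : forall x y z, qdiv x y = z <-> x = qop z y
}.

#[short(type="quandleType")]
HB.structure Definition Quandle := { X of isQuandle X }.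

#[short(type="finQuandleType")]
HB.structure Definition FinQuandle := { X of isQuandle X & Finite X }.

Notation "x |> y" := (qop x y)
  (at level 40, left associativity) : quandle_scope.
Notation "x |>^-1 y" := (qdiv x y)
  (at level 40, left associativity) : quandle_scope.

Local Open Scope quandle_scope.

Definition quandle_hom (X Y : quandleType) (f : X -> Y) : Prop :=
  (forall x y, f (x |> y) = f x |> f y) /\
  (forall x y, f (x |>^-1 y) = f x |>^-1 f y).

Definition simple_quandle (X : finQuandleType) : Prop :=
  (1 < #|X|)%N /\
  forall (Y : quandleType) (f : X -> Y), quandle_hom f ->
    injective f \/ exists c : Y, forall x, f x = c.

Lemma qop_inj (X : quandleType) (x : X) : injective (fun y => y |> x).
Proof. exact: bij_inj (qop_bij x). Qed.

Definition rtrans (X : finQuandleType) (x : X) : {perm X} :=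
  perm (@qop_inj X x).

Definition Inn (X : finQuandleType) : {group {perm X}} :=
  <<[set rtrans x | x : X]>>%G.

Definition quasiprimitive (gT : finGroupType) (T : finType)
    (to : {action gT &-> T}) (G : {group gT}) : Prop :=
  [faithful G, on [set: T] | to] /\
  forall N : {group gT}, (N <| G)%g -> N :!=: 1%g ->
    [transitive N, on [set: T] | to].

(* Main.v *)
Require Import Defs.
From mathcomp Require Import all_boot all_fingroup generic_quotient.
From HB Require Import structures.

(** Let N be a nontrivial normal subgroup of Inn X.  The point is that the
    orbits of N are the classes of a congruence of the quandle X, so that the
    projection onto the quotient quandle X / N is a homomorphism to which
    simplicity applies.  If it is injective, all N-orbits are singletons and N
    is trivial; if it is constant, there is only one orbit.

    Compatibility in the left argument of |> holds because R_z normalises N,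
    hence permutes its orbits ([orbit_qop_l]).  Compatibility in the right
    argument uses that inner automorphisms g satisfy R_(g z) = g^-1 R_z g
    ([rtrans_Inn]): for n in N this element lies in the coset R_z N, so R_(n z)
    and R_z send any point into the same N-orbit ([orbit_qop_r]). *)

Local Open Scope quandle_scope.
Local Open Scope quotient_scope.
Local Open Scope group_scope.

(** * Congruences of simple quandles *)

Lemma qdivK {Y : quandleType} (x y : Y) : (x |>^-1 y) |> y = x.
Proof. by apply/esym/(iffLR (qdivP _ _ _)). Qed.

Lemma qopK {Y : quandleType} (x y : Y) : (x |> y) |>^-1 y = x.
Proof. exact/qdivP. Qed.

(** Asking for an equality, not an implication, in the left argument makes the
    relation compatible with |>^-1 as well; this is what makes right
    translations of the quotient bijective. *)
Lemma simple_quandle_congruence {X : finQuandleType} {e : equiv_rel X} :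
    simple_quandle X ->
    (forall x y z, e (x |> z) (y |> z) = e x y) ->
    (forall x y z, e y z -> e (x |> y) (x |> z)) ->
  (forall x y, e x y -> x = y) \/ (forall x y, e x y).
Proof.
move=> [_ simpleX] e_l e_r.
have e_op x x' y y' : e x x' -> e y y' -> e (x |> y) (x' |> y').
  by move=> exx' eyy'; apply: equiv_trans (e_r x' _ _ eyy'); rewrite e_l.
have e_div x x' y y' : e x x' -> e y y' -> e (x |>^-1 y) (x' |>^-1 y').
  move=> exx' eyy'; rewrite -(e_l _ _ y) qdivK.
  apply: (equiv_trans exx'); rewrite -{1}(qdivK x' y').
  by apply: e_r; rewrite equiv_sym.
pose Q := {eq_quot e}; pose pi x : Q := \pi_Q x.
have piP x y : reflect (pi x = pi y) (e x y) by apply: eqmodP.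
have reprP x : e (repr (pi x)) x by apply/piP; rewrite /pi reprK.
pose op (a b : Q) := pi (repr a |> repr b).
pose div (a b : Q) := pi (repr a |>^-1 repr b).
have opE x y : op (pi x) (pi y) = pi (x |> y) by apply/piP/e_op.
have divE x y : div (pi x) (pi y) = pi (x |>^-1 y) by apply/piP/e_div.
have pi_surj (a : Q) : exists x, a = pi x.
  by exists (repr a); rewrite /pi reprK.
have opxx a : op a a = a.
  by have [x ->] := pi_surj a; rewrite opE qopxx.
have opK a b : div (op a b) b = a.
  by have [[x ->] [y ->]] := (pi_surj a, pi_surj b); rewrite opE divE qopK.
have divK a b : op (div a b) b = a.
  by have [[x ->] [y ->]] := (pi_surj a, pi_surj b); rewrite divE opE qdivK.
have op_bij b : bijective (fun a => op a b).
  by exists (fun a => div a b) => a.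
have opD a b c : op (op a b) c = op (op a c) (op b c).
  have [[x ->] [y ->]] := (pi_surj a, pi_surj b).
  by have [z ->] := pi_surj c; rewrite !opE qopDr.
have divP a b c : div a b = c <-> a = op c b.
  by split=> [<- | ->]; rewrite ?divK ?opK.
pose Y : quandleType := HB.pack Q (isQuandle.Build Q opxx op_bij opD divP).
have pi_hom : @quandle_hom X Y pi by split=> x y; rewrite -?opE -?divE.
have [pi_inj | [c pi_c]] := simpleX Y pi pi_hom.
  by left=> x y /piP/pi_inj.
by right=> x y; apply/piP; rewrite !pi_c.
Qed.

(** * Orbits of normal subgroups of the inner automorphism group *)

Section Inner.

Context {X : finQuandleType}.
Implicit Types (x y z : X) (g : {perm X}).

Lemma rtransE x y : rtrans x y = y |> x. Proof. exact: permE. Qed.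

Lemma rtrans_in_Inn x : rtrans x \in Inn X.
Proof. exact/mem_gen/imset_f. Qed.

(** On the generators of Inn X this is self-distributivity, and the
    permutations g with this property form a group. *)
Lemma rtrans_Inn g z : g \in Inn X -> rtrans (g z) = rtrans z ^ g.
Proof.
pose A := [set g : {perm X} | [forall z, rtrans (g z) == rtrans z ^ g]].
have AP (h : {perm X}) : reflect (forall z, rtrans (h z) = rtrans z ^ h) (h \in A).
  by rewrite inE; apply: 'forall_eqP.
have gA : group_set A.
  apply/group_setP; split=> [|h k /AP hA /AP kA]; apply/AP => x.
    by rewrite perm1 conjg1.
  by rewrite permM kA hA conjgM.
suff /subsetP sIA : Inn X \subset Group gA by move/sIA/AP.
rewrite gen_subG; apply/subsetP => _ /imsetP[x _ ->]; apply/AP => y.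
rewrite conjgE; apply: (mulgI (rtrans x)); rewrite mulKVg.
by apply/permP => u; rewrite !permM !rtransE -qopDr.
Qed.

Context {N : {group {perm X}}} (nN : N <| Inn X).

Lemma rtrans_norm z : rtrans z \in 'N(N).
Proof. exact: (subsetP (normal_norm nN)) (rtrans_in_Inn z). Qed.

Lemma orbit_qop_l x y z :
  (y |> z \in orbit 'P N (x |> z)) = (y \in orbit 'P N x).
Proof.
rewrite -!rtransE -[rtrans z x]/('P%act x _) -{1}(normP (rtrans_norm z)).
exact: orbit_conjsg.
Qed.

Lemma orbit_qop_r x y z :
  z \in orbit 'P N y -> x |> z \in orbit 'P N (x |> y).
Proof.
case/orbitP => n nNn <-; rewrite -[('P)%act y n]/(n y) -!rtransE.
rewrite rtrans_Inn ?(subsetP (normal_sub nN)) //.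
(* n^-1 R_y n = R_y (n^-1)^(R_y) n, with the last two factors in N *)
have -> : rtrans y ^ n = rtrans y * (n^-1 ^ rtrans y * n).
  by rewrite !conjgE !mulgA mulgV mul1g.
rewrite permM; apply: (mem_orbit 'P); rewrite groupM //.
by rewrite memJ_norm ?groupV ?rtrans_norm.
Qed.

End Inner.

(** * Quasiprimitivity *)

Theorem theorem3p1 (X : finQuandleType) (hX : simple_quandle X) :
  quasiprimitive 'P (Inn X).
Proof.
split=> [|N nN ntN]; first exact: perm_faithful.
pose e x y := y \in orbit 'P N x.
have e_equiv : equiv_class_of e.
  split=> [x | x y | y x z]; rewrite /e.
  - exact: orbit_refl.
  - exact: orbit_sym.
  - by move=> exy eyz; apply: orbit_trans eyz exy.
pose eR := EquivRelPack e_equiv.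
have [triv | total] := simple_quandle_congruence (e := eR) hX
  (fun x y z => orbit_qop_l nN x y z) (fun x y z => @orbit_qop_r _ _ nN x y z).
  case/negP: ntN; rewrite -subG1; apply/subsetP => n nNn.
  rewrite inE; apply/eqP/permP => x; rewrite perm1.
  by apply/esym/triv/(mem_orbit 'P).
have [x] : exists x, x \in [set: X].
  by apply/set0Pn; rewrite -card_gt0 cardsT; case: hX => /ltnW.
move=> xT; apply/imsetP; exists x => //.
by apply/setP => y; rewrite inE; apply/esym/total.
Qed.
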